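(* Let $k \in \mathbb{N}$. The thinness of a tree $T$ is greater than $k$ if and only if $|N^k(x)| \geq 3$ for some vertex $x \in V(T)$, where $N^k(x)$ denotes the set of $k$-neighbors of $x$ in $T$.
   Context: A graph $G$ is $k$-thin if there exist a strict total order $\prec$ on $V(G)$ and a partition of $V(G)$ into $k$ classes such that for all $u \prec v \prec w$ with $u,v$ in the same class and $(u,w)\in E(G)$, also $(v,w)\in E(G)$; the thinness $\mathrm{thin}(G)$ is the minimum such $k$. For adjacent vertices $v,u$ of a tree $T$, the dangling tree from $v$ in $u$ is the connected component of $T$ minus the edge $(v,u)$ that contains $u$. For a vertex $x$ of $T$, a neighbor $v$ of $x$ is a $k$-neighbor of $x$ if $v$ has a neighbor $u \neq x$ such that the dangling tree from $v$ in $u$ has thinness at least $k$; $N^k(x)$ is the set of $k$-neighbors of $x$. *)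

(* Defs.v *)
From mathcomp Require Import all_boot.

Set Implicit Arguments.
Unset Strict Implicit.
Unset Printing Implicit Defensive.

(* A graph is given by its adjacency relation [e : rel T] on a finite vertex
   type [T]; simplicity (symmetry, irreflexivity) is part of [is_tree]. *)

Section Thinness.

Variables (T : finType) (e : rel T).

(* A binary relation on [T] is encoded as a set of pairs, so that one can
   quantify over relations in [bool]. *)
Definition strict_total_order (lt : {set T * T}) : bool :=
  [&& [forall x, (x, x) \notin lt],
      [forall x, forall y, forall z,
        [&& (x, y) \in lt & (y, z) \in lt] ==> ((x, z) \in lt)]
    & [forall x, forall y,
        (x != y) ==> (((x, y) \in lt) || ((y, x) \in lt))]].

Definition consistent (lt : {set T * T}) (P : {set {set T}}) : bool :=
  [forall C in P, forall u in C, forall v in C, forall w,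
    [&& (u, v) \in lt, (v, w) \in lt & e u w] ==> e v w].

Definition k_thin (k : nat) : bool :=
  [exists lt : {set T * T}, exists P : {set {set T}},
    [&& strict_total_order lt, partition P [set: T], #|P| == k
      & consistent lt P]].

Lemma ex_k_thin : exists k, k_thin k.
Proof.
pose lt : {set T * T} := [set p | enum_rank p.1 < enum_rank p.2].
pose P := preim_partition (@id T) [set: T].
have PP : partition P [set: T] := preim_partitionP _ _.
exists #|P|; apply/existsP; exists lt; apply/existsP; exists P.
rewrite PP eqxx /=; apply/andP; split.
  apply/and3P; split.
  - by apply/forallP=> x; rewrite inE ltnn.
  - apply/forallP=> x; apply/forallP=> y; apply/forallP=> z.
    by rewrite !inE; apply/implyP=> /andP[]; apply: ltn_trans.
  - apply/forallP=> x; apply/forallP=> y; apply/implyP.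
    by rewrite !inE -neq_ltn -(inj_eq (@enum_rank_inj T)).
apply/forall_inP=> C /imsetP[x _ ->].
apply/forall_inP=> u; rewrite !inE /= => /eqP <-.
apply/forall_inP=> v; rewrite !inE /= => /eqP <-.
by apply/forallP=> w; rewrite inE ltnn.
Qed.

Definition thin : nat := ex_minn ex_k_thin.

End Thinness.

Section Trees.

Variables (T : finType) (e : rel T).

(* [ucycle e c] also holds for the degenerate cycles [:: x; y] running back
   and forth along an edge; the cycles of a simple graph have size at least 3. *)
Definition acyclic : Prop := forall c : seq T, ucycle e c -> size c < 3.

Definition is_tree : Prop :=
  [/\ 0 < #|T|, symmetric e, irreflexive e, (forall x y, connect e x y)
    & acyclic].

Definition del_edge (v u : T) : rel T :=
  [rel x y | [&& e x y, (x, y) != (v, u) & (x, y) != (u, v)]].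

(* Vertex type of the dangling tree from [v] in [u]. *)
Definition dangling (v u : T) : finType :=
  {y : T | connect (del_edge v u) u y}.

Definition dangling_adj (v u : T) : rel (dangling v u) :=
  [rel y z | del_edge v u (val y) (val z)].

Definition k_neighbors (k : nat) (x : T) : {set T} :=
  [set v | e x v &&
    [exists u, [&& e v u, u != x & k <= thin (@dangling_adj v u)]]].

End Trees.

(* Main.v *)
Require Import Defs.
From mathcomp Require Import all_boot zify.

(* Fix a vertex order.  Classes consistent with it are chains of the partial
   order "u comes before v and every neighbour of u after v is a neighbour of
   v", so by Dilworth's theorem a tree of thinness at least k contains a
   k-antichain of it.

   If x has three k-neighbours, this gives three such antichains, in disjoint
   branches at x; let t1 < t2 < t3 be their last elements.  The path from t1 to
   t3 avoids the neighbourhood of the branch of t2, and the left end of its edge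
   jumping over t2 extends the second antichain to k + 1 elements.

   Conversely, if every N^k(x) has at most two elements, there is a path P
   containing N^k(y) for all of its vertices y: a maximal path of mutual
   k-neighbours, or a single vertex with no k-neighbour if there are no such
   pairs (if every vertex had a k-neighbour, a pair (z, y), y in N^k(z), with the
   smallest dangling tree would be mutual).  All trees hanging off N[P] then have
   thinness less than k; a layout of T uses one class for N[P] and inserts each
   hanging tree right after the vertex of N[P] it is attached to. *)

Set Implicit Arguments.
Unset Strict Implicit.
Unset Printing Implicit Defensive.

(** * Dilworth's theorem for finite strict orders *)

Section Dilworth.

Variables (T : finType) (r : rel T).
Hypotheses (r_irr : irreflexive r) (r_trans : transitive r).

Definition antichain (X : {set T}) : bool :=
  [forall x in X, forall y in X, ~~ r x y].

Definition chain_coloring (A : {set T}) (n : nat) (c : T -> nat) : Prop :=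
  (forall x, x \in A -> c x < n) /\
  (forall x y, x \in A -> y \in A -> c x = c y -> x != y -> r x y || r y x).

Lemma antichainP (X : {set T}) :
  reflect (forall x y, x \in X -> y \in X -> ~~ r x y) (antichain X).
Proof.
apply: (iffP forall_inP) => [H x y xX yX | H x xX].
  by move/forall_inP: (H x xX); apply.
by apply/forall_inP=> y; apply: H.
Qed.

Lemma exists_maximal (A : {set T}) (x : T) :
  x \in A -> exists2 m, m \in A & forall y, y \in A -> ~~ r m y.
Proof.
move=> xA; case: (arg_minnP (fun y => #|[set z in A | r y z]|) xA) => m mA mmin.
exists m => // y yA; apply/negP=> rmy.
have := mmin y yA; rewrite leqNgt => /negP; apply.
apply/proper_card/properP; split.
  apply/subsetP=> z; rewrite !inE => /andP[-> ryz].
  exact: r_trans rmy ryz.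
by exists y; rewrite !inE yA ?rmy // r_irr.
Qed.

Lemma card_inj_nat (X : {set T}) (n : nat) (c : T -> nat) :
  (forall x, x \in X -> c x < n) -> {in X &, injective c} -> #|X| <= n.
Proof.
move=> cn cinj; rewrite cardE -(size_map c) -[n in _ <= n](size_iota 0).
apply: uniq_leq_size.
  by rewrite map_inj_in_uniq ?enum_uniq // => x y; rewrite !mem_enum; apply: cinj.
by move=> i /mapP[x]; rewrite mem_enum mem_iota => /cn xn ->.
Qed.

Lemma antichain_coloring_inj (A X : {set T}) n c :
  chain_coloring A n c -> X \subset A -> antichain X -> {in X &, injective c}.
Proof.
move=> [_ cch] /subsetP XA /antichainP aX x y xX yX cxy; apply/eqP/negPn/negP=> xy.
have := cch x y (XA x xX) (XA y yX) cxy xy.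
by rewrite (negPf (aX x y xX yX)) (negPf (aX y x yX xX)).
Qed.

Lemma antichain_leq (A X : {set T}) n c :
  chain_coloring A n c -> X \subset A -> antichain X -> #|X| <= n.
Proof.
move=> cc XA aX; apply: (@card_inj_nat _ _ c); last exact: antichain_coloring_inj cc XA aX.
by move=> x /(subsetP XA); apply: cc.1.
Qed.

(** An antichain has pairwise distinct colours, so with as many elements as there are colours it
    uses all of them. *)
Lemma antichain_meets_color (A X : {set T}) n c i :
  chain_coloring A n c -> X \subset A -> antichain X -> #|X| = n -> i < n ->
  exists2 x, x \in X & c x = i.
Proof.
move=> cc XA aX Xn lin.
have cinj := antichain_coloring_inj cc XA aX.
have un : uniq (map c (enum X)).
  by rewrite map_inj_in_uniq ?enum_uniq // => x y; rewrite !mem_enum; apply: cinj.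
have sub : {subset map c (enum X) <= iota 0 n}.
  move=> j /mapP[x]; rewrite mem_enum mem_iota => xX ->.
  by apply: cc.1; apply: (subsetP XA).
have [|_ eqi] := uniq_min_size un sub.
  by rewrite size_iota size_map -cardE Xn.
have : i \in iota 0 n by rewrite mem_iota.
by rewrite -eqi => /mapP[x]; rewrite mem_enum => xX ->; exists x.
Qed.

Lemma ltn_leq_pred a b n : a < b -> b < n -> a < n.-1.
Proof. lia. Qed.

(* Galvin's proof: [X1] below collects the topmost element of each chain of
   [A :\ m] that lies in some maximum antichain. *)
Theorem dilworth (A : {set T}) :
  exists (X : {set T}) (c : T -> nat), [/\ X \subset A, antichain X & chain_coloring A #|X| c].
Proof.
move: {2}#|A|.+1 (ltnSn #|A|) => N; elim: N => // N IH in A *; rewrite ltnS => leAN.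
have [-> | [x0 x0A]] := set_0Vmem A.
  exists set0, (fun=> 0); split; rewrite ?sub0set //.
    by apply/antichainP=> x y; rewrite inE.
  by split=> x; rewrite inE.
have [m mA mmax] := exists_maximal x0A.
have leA' : #|A :\ m| < N by rewrite (cardsD1 m) mA in leAN.
have [X0 [c0 [X0A aX0 cc0]]] := IH _ leA'.
set n := #|X0| in cc0.
pose good z := [exists Y : {set T}, [&& Y \subset A :\ m, antichain Y, #|Y| == n & z \in Y]].
have goodA z : good z -> z \in A :\ m.
  by case/existsP=> Y /and4P[/subsetP YA _ _]; apply: YA.
have top i : i < n -> exists a, [/\ good a, c0 a = i
    & forall z, good z -> c0 z = i -> (z == a) || r z a].
  move=> lin; have [x xX cx] := antichain_meets_color cc0 X0A aX0 erefl lin.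
  have xG : x \in [set z | good z & c0 z == i].
    by rewrite inE cx eqxx andbT; apply/existsP; exists X0; rewrite X0A aX0 xX eqxx.
  have [a] := exists_maximal xG; rewrite inE => /andP[ga /eqP ca] amax.
  exists a; split=> // z gz cz; case: eqVneq => //= nza.
  have := cc0.2 z a (goodA _ gz) (goodA _ ga); rewrite cz ca => /(_ erefl nza).
  by rewrite orbC (negPf (amax z _)) // inE gz cz eqxx.
(* If a good [b] were above the top [a], a maximum antichain through [b] would contain some [y] of
   the colour of [a]; then [y] is at or below [a], hence below [b]. *)
have below a i : good a -> c0 a = i -> i < n ->
    (forall z, good z -> c0 z = i -> (z == a) || r z a) ->
    forall b, r a b -> good b -> False.
  move=> ga ca lin amax b rab /existsP[Y /and4P[YA aY /eqP Yn bY]].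
  have [y yY cy] := antichain_meets_color cc0 YA aY Yn lin.
  have gy : good y by apply/existsP; exists Y; rewrite YA aY Yn eqxx yY.
  have ryb : r y b by case/orP: (amax y gy cy) => [/eqP->|/r_trans]; last apply.
  by have /antichainP/(_ y b yY bY) := aY; rewrite ryb.
pose istop a := [&& good a & [forall z, good z && (c0 z == c0 a) ==> (z == a) || r z a]].
have istopP a : istop a -> good a /\ 
    (forall z, good z -> c0 z = c0 a -> (z == a) || r z a).
  case/andP=> ga /forallP H; split=> // z gz cz.
  by have := H z; rewrite gz cz eqxx.
have c0lt a : good a -> c0 a < n by move/goodA; apply: cc0.1.
have [/existsP[a /andP[ta ram]] | /existsPn notop] :=
    boolP [exists a, istop a && r a m].
  have [ga amax] := istopP _ ta.
  (* [K] is a chain with top [m]. An antichain of size [n] in [A :\: K] would contain a good element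
     of the colour of [a], but such elements lie in [K]. So fewer than [n] colours suffice off [K],
     and [K] takes the colour [n.-1]. *)
  pose K := m |: [set z in A :\ m | (c0 z == c0 a) && ((z == a) || r z a)].
  have KP z : z \in K ->
      z = m \/ [/\ z \in A :\ m, c0 z = c0 a & (z == a) || r z a].
    by case/setU1P=> [->|]; [left | rewrite inE => /and3P[? /eqP ? ?]; right].
  have Km z : (z == a) || r z a -> r z m.
    by case/orP=> [/eqP->//|rza]; apply: r_trans rza ram.
  have KA : K \subset A.
    apply/subsetP=> z; rewrite !inE => /orP[/eqP->//|/andP[/andP[]]//].
  have leK : #|A :\: K| < N.
    apply: leq_trans leAN; apply: proper_card; apply/properP; split.
      exact: subsetDl.
    by exists m; rewrite ?inE ?eqxx.
  have [X1 [c1 [X1A aX1 cc1]]] := IH _ leK.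
  have X1A' : X1 \subset A :\ m.
    apply: (subset_trans X1A); apply/subsetP=> z; rewrite !inE negb_or.
    by case/andP=> /andP[-> _] ->.
  have ltX1 : #|X1| < n.
    rewrite ltn_neqAle (antichain_leq cc0 X1A' aX1) andbT; apply/eqP=> X1n.
    have [y yX cy] := antichain_meets_color cc0 X1A' aX1 X1n (c0lt _ ga).
    have gy : good y by apply/existsP; exists X1; rewrite X1A' aX1 X1n eqxx.
    have := subsetP X1A y yX; rewrite !inE.
    have := subsetP X1A' y yX; rewrite !inE => /andP[/negPf-> ->].
    by rewrite cy eqxx amax.
  exists X0, (fun z => if z \in K then n.-1 else c1 z); split=> //.
    by apply: (subset_trans X0A); exact: subsetDl.
  have D z : z \in A -> z \notin K -> z \in A :\: K by rewrite in_setD => -> ->.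
  have lec1 z : z \in A -> z \notin K -> c1 z < n.-1.
    by move=> zA zK; apply: ltn_leq_pred (cc1.1 z (D z zA zK)) ltX1.
  split=> [z zA | y z yA zA].
    case: ifP => [_|/negbT zK]; first by rewrite ltn_predL (leq_ltn_trans _ ltX1).
    by apply: leq_trans (lec1 z zA zK) (leq_pred _).
  case: ifP => [yK|/negbT yK]; case: ifP => [zK|/negbT zK] => ceq.
  - move=> nyz; case: (KP y yK) => [ym|[yA' cy rya]];
      case: (KP z zK) => [zm|[zA' cz rza]].
    + by rewrite ym zm eqxx in nyz.
    + by rewrite ym (Km z rza) orbT.
    + by rewrite zm (Km y rya).
    + by apply: cc0.2; rewrite ?cy ?cz.
  - by have := lec1 z zA zK; rewrite -ceq ltnn.
  - by have := lec1 y yA yK; rewrite ceq ltnn.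
  - by apply: cc1.2 => //; apply: D.
(* With no top below the maximal element [m], the tops together with [m] form an antichain of size
   [n.+1], and [m] becomes a chain of its own. *)
pose X1 := [set a | istop a].
have X1A : X1 \subset A :\ m.
  by apply/subsetP=> a; rewrite inE => /istopP[/goodA].
have aX1 : antichain X1.
  apply/antichainP=> a b; rewrite !inE => /istopP[ga amax] /istopP[gb _].
  by apply/negP=> rab; apply: below rab gb => //; exact: c0lt.
have X1n : n <= #|X1|.
  rewrite cardE -(size_map c0) -[n in n <= _](size_iota 0).
  apply: uniq_leq_size; first exact: iota_uniq.
  move=> i; rewrite mem_iota => /top[a [ga ca amax]].
  apply/mapP; exists a => //; rewrite mem_enum inE /istop ga /=.
  apply/forallP=> z; apply/implyP=> /andP[gz /eqP cz]; apply: amax => //.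
  by rewrite cz.
have mX1 : m \notin X1 by apply/negP=> /(subsetP X1A); rewrite !inE eqxx.
have cX1 : #|m |: X1| = n.+1.
  rewrite cardsU1 mX1 add1n; congr _.+1; apply/eqP.
  by rewrite eqn_leq X1n (antichain_leq cc0 X1A aX1).
exists (m |: X1), (fun z => if z == m then n else c0 z); split.
- by rewrite subUset sub1set mA (subset_trans X1A) // subsetDl.
- have X1A2 z : z \in X1 -> z \in A by move/(subsetP X1A); rewrite !inE => /andP[].
  apply/antichainP=> a b; rewrite !in_setU1.
  case/predU1P=> [->|aX]; case/predU1P=> [->|bX].
  + by rewrite r_irr.
  + by apply: mmax; apply: X1A2.
  + by have := notop a; rewrite inE in aX; rewrite aX.
  + by have /antichainP := aX1; apply.
- rewrite cX1; split=> [z zA | y z yA zA].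
    case: eqVneq => [//|zm]; apply: leqW; apply: cc0.1; by rewrite !inE zm.
  have D t : t \in A -> t != m -> t \in A :\ m by rewrite !inE => -> ->.
  case: (eqVneq y m) => [->|ym]; case: (eqVneq z m) => [->|zm] //.
  + by move=> E; have := cc0.1 z (D z zA zm); rewrite -E ltnn.
  + by move=> E; have := cc0.1 y (D y yA ym); rewrite E ltnn.
  + by apply: cc0.2; apply: D.
Qed.

End Dilworth.

(** * Layouts of vertex sets and their relation to thinness *)

Section Layout.

Variables (T : finType) (e : rel T).

(** Order and classes become numberings of the whole type, so that layouts of vertex subsets can be
    restricted and glued; some of the [j] classes may be empty. *)
Definition layout (A : {set T}) (j : nat) (f c : T -> nat) : Prop :=
  [/\ {in A &, injective f}, forall x, x \in A -> c x < j
    & forall u v w, u \in A -> v \in A -> w \in A ->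
        f u < f v -> f v < f w -> c u = c v -> e u w -> e v w].

Definition has_layout (A : {set T}) (j : nat) : Prop :=
  exists f c : T -> nat, layout A j f c.

Lemma has_layout_sub (A B : {set T}) i j :
  A \subset B -> i <= j -> has_layout B i -> has_layout A j.
Proof.
move=> /subsetP AB ij [f [c [finj cj con]]]; exists f, c; split.
- by move=> x y /AB xB /AB yB; apply: finj.
- by move=> x /AB/cj cx; apply: leq_trans cx ij.
- by move=> u v w /AB uB /AB vB /AB wB; apply: con.
Qed.

Lemma k_thin_layout k : k_thin e k -> has_layout [set: T] k.
Proof.
case/existsP=> lt /existsP[P /and4P[/and3P[lt_irr lt_tr lt_tot] partP /eqP <- con]].
have irr x : (x, x) \in lt = false by apply/negbTE; have /forallP := lt_irr.
have tr x y z : (x, y) \in lt -> (y, z) \in lt -> (x, z) \in lt.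
  move=> xy yz; have /forallP/(_ x)/forallP/(_ y)/forallP/(_ z) := lt_tr.
  by rewrite xy yz.
have tot x y : x != y -> ((x, y) \in lt) || ((y, x) \in lt).
  by move=> xy; have /forallP/(_ x)/forallP/(_ y) := lt_tot; rewrite xy.
pose f x := #|[set y | (y, x) \in lt]|.
have fmono x y : (x, y) \in lt -> f x < f y.
  move=> xy; apply/proper_card/properP; split.
    by apply/subsetP=> z; rewrite !inE => /tr; apply.
  by exists x; rewrite inE ?xy ?irr.
have fE x y : f x < f y -> (x, y) \in lt.
  move=> fxy; have : x != y by apply: contraTneq fxy => ->; rewrite ltnn.
  by case/tot/orP=> // /fmono; rewrite ltnNge (ltnW fxy).
have covP x : x \in cover P by rewrite (cover_partition partP).
have blockP x : pblock P x \in P by rewrite pblock_mem.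
exists f, (fun x => index (pblock P x) (enum P)); split.
- move=> x y _ _ fxy; apply/eqP/negPn/negP=> /tot /orP[] /fmono;
    by rewrite fxy ltnn.
- by move=> x _; rewrite cardE index_mem mem_enum.
- move=> u v w _ _ _ /fE uv /fE vw ceq euw.
  have {ceq} beq : pblock P u = pblock P v.
    by rewrite -(nth_index set0 (s := enum P) (x := pblock P u)) ?mem_enum // ceq
       nth_index ?mem_enum.
  have uB : u \in pblock P v by rewrite -beq mem_pblock.
  have vB : v \in pblock P v by rewrite mem_pblock.
  move/forall_inP: con => /(_ _ (blockP v))/forall_inP/(_ u uB)/forall_inP/(_ v vB).
  by move/forallP/(_ w); rewrite uv vw euw.
Qed.

Lemma layout_thin j : has_layout [set: T] j -> thin e <= j.
Proof.
case=> f [c [finj cj con]].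
pose lt : {set T * T} := [set p | f p.1 < f p.2].
pose P := preim_partition c [set: T].
have Pj : #|P| <= j.
  pose h (i : 'I_j) := [set y | c y == i].
  suff /subset_leq_card le_h : P \subset h @: 'I_j.
    by apply: leq_trans le_h _; rewrite -[leqRHS]card_ord leq_imset_card.
  apply/subsetP=> C /imsetP[x _ ->].
  apply/imsetP; exists (Ordinal (cj x (in_setT _))) => //.
  by apply/setP=> y; rewrite !inE eq_sym.
apply: leq_trans Pj; rewrite /thin; case: ex_minnP => n _; apply.
apply/existsP; exists lt; apply/existsP; exists P.
rewrite preim_partitionP eqxx /=; apply/andP; split.
  apply/and3P; split.
  - by apply/forallP=> x; rewrite inE ltnn.
  - apply/forallP=> x; apply/forallP=> y; apply/forallP=> z.
    by rewrite !inE; apply/implyP=> /andP[]; apply: ltn_trans.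
  - apply/forallP=> x; apply/forallP=> y; apply/implyP.
    rewrite !inE -neq_ltn; by apply: contra_neq => /finj; rewrite !inE; apply.
apply/forall_inP=> C /imsetP[x _ ->].
apply/forall_inP=> u; rewrite !inE /= => /eqP cu.
apply/forall_inP=> v; rewrite !inE /= => /eqP cv.
apply/forallP=> w; rewrite !inE /=; apply/implyP=> /and3P[uv vw].
by apply: con => //; rewrite -cu.
Qed.

Lemma thin_leP j : thin e <= j <-> has_layout [set: T] j.
Proof.
split=> [le_j|]; last exact: layout_thin.
apply: has_layout_sub (subxx _) le_j _; apply: k_thin_layout.
by rewrite /thin; case: ex_minnP.
Qed.

(** Dilworth's theorem for the order [r]: chains are consistent classes, and [w] witnesses that [a]
    and [b] cannot share a class. So [#|X|] is the exact number of classes that the order [f]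
    requires on [A]. *)
Lemma order_clique (A : {set T}) (f : T -> nat) : {in A &, injective f} ->
  exists (X : {set T}) (c : T -> nat),
  [/\ X \subset A, layout A #|X| f c &
    forall a b, a \in X -> b \in X -> f a < f b ->
      exists w, [/\ w \in A, f b < f w, e a w & ~~ e b w]].
Proof.
move=> finj.
pose r := [rel u v | (f u < f v) && [forall w in A, (f v < f w) && e u w ==> e v w]].
have r_irr : irreflexive r by move=> x /=; rewrite ltnn.
have r_trans : transitive r.
  move=> v u w /= /andP[uv /forall_inP Huv] /andP[vw /forall_inP Hvw].
  rewrite (ltn_trans uv vw); apply/forall_inP=> z zA; apply/implyP=> /andP[wz euz].
  have evz : e v z by have := Huv z zA; rewrite (ltn_trans vw wz) euz.
  by have := Hvw z zA; rewrite wz evz.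
have [X [c [XA /antichainP aX [cX ch]]]] := dilworth r_irr r_trans A.
exists X, c; split=> //.
  split=> // u v w uA vA wA uv vw ceq euw.
  have nuv : u != v by apply: contraTneq uv => ->; rewrite ltnn.
  case/orP: (ch u v uA vA ceq nuv) => /= /andP[ruv /forall_inP H].
    by have := H w wA; rewrite vw euw.
  by rewrite ltnNge (ltnW uv) in ruv.
move=> a b aIX bIX ab; have := aX a b aIX bIX; rewrite /= ab /=.
case/forall_inPn=> w wA; rewrite negb_imply => /andP[/andP[bw eaw] nebw].
by exists w.
Qed.

(** Each [D] is closed under adjacency within [A], so pieces can be placed one after another with
    the same [j] classes: an edge [u w] lies in one piece, and so does every vertex between its
    ends. *)
Lemma has_layout_cover (A : {set T}) j :
  symmetric e ->
  (forall z, z \in A -> exists D : {set T}, [/\ has_layout D j, z \in D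
     & forall y y', y \in D -> y' \in A -> e y y' -> y' \in D]) ->
  has_layout A j.
Proof.
move=> esym; move: {2}#|A|.+1 (ltnSn #|A|) => N; elim: N => // N IH in A *.
rewrite ltnS => leAN cov.
have [-> | [z zA]] := set_0Vmem A.
  exists (fun=> 0), (fun=> 0); split=> [x y | x | u v w]; by rewrite inE.
have [D [layD zD clD]] := cov z zA.
have ltAD : #|A :\: D| < N.
  apply: leq_trans leAN; apply: proper_card; apply/properP; split.
    exact: subsetDl.
  by exists z; rewrite // inE zD.
have {}layD := has_layout_sub (subsetIr A D) (leqnn j) layD.
have [|f1 [c1 [inj1 lt1 con1]]] := IH _ ltAD.
  move=> y; rewrite inE => /andP[_ /cov[D' [? ? cl]]]; exists D'; split=> //.
  by move=> y1 y2 yD; rewrite inE => /andP[_]; apply: cl.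
have [f2 [c2 [inj2 lt2 con2]]] := layD.
pose M := (\max_x f2 x).+1.
have f2M x : f2 x < M by rewrite ltnS; apply: leq_bigmax.
have cases x : x \in A -> (x \in D /\ x \in A :&: D) \/ (x \in D = false /\ x \in A :\: D).
  by move=> xA; rewrite !inE xA; case: (x \in D); [left|right].
exists (fun x => if x \in D then f2 x else M + f1 x), (fun x => if x \in D then c2 x else c1 x).
split.
- move=> x y /cases[] [-> xA] /cases[] [-> yA].
  + exact: inj2.
  + by have := f2M x => + E; rewrite E ltnNge leq_addr.
  + by have := f2M y => + E; rewrite -E ltnNge leq_addr.
  + by move/addnI; apply: inj1.
- by move=> x /cases[] [-> xA]; [apply: lt2 | apply: lt1].
- move=> u v w uA vA wA.
  have edgeD y y' : y \in A -> y' \in A -> e y y' -> (y \in D) = (y' \in D).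
    move=> yA y'A eyy'; apply/idP/idP=> [yD|y'D]; first exact: clD eyy'.
    by apply: clD y'D yA _; rewrite esym.
  case: (cases u uA) => -[uD uA']; case: (cases w wA) => -[wD wA'];
    rewrite ?uD ?wD => uv vw ceq euw; try by have := edgeD u w uA wA euw; rewrite uD wD.
  + case: (cases v vA) uv vw ceq => -[-> vA'] uv vw ceq; first exact: con2 uv vw ceq euw.
    by have := f2M w; rewrite ltnNge (leq_trans _ (ltnW vw)) ?leq_addr.
  + case: (cases v vA) uv vw ceq => -[-> vA'] uv vw ceq.
      by have := f2M v; rewrite ltnNge (leq_trans _ (ltnW uv)) ?leq_addr.
    by rewrite !ltn_add2l in uv vw; exact: con1 uv vw ceq euw.
Qed.

End Layout.

(** Lets the thinness of a dangling tree, whose vertices form a subtype, be handled through layouts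
    of a vertex subset. *)
Lemma has_layout_val (T : finType) (e : rel T) (A : {set T}) (p : pred T)
    (e' : rel {y | p y}) j :
  (forall y, y \in A = p y) -> (forall y z, e' y z = e (val y) (val z)) ->
  thin e' <= j <-> has_layout e A j.
Proof.
move=> AP e'E; rewrite thin_leP; split.
  case=> f [c [finj cj con]].
  pose F (g : {y | p y} -> nat) x := if insub x is Some y then g y else 0.
  have FE g (y : {y | p y}) : F g (val y) = g y by rewrite /F valK.
  have valA x : x \in A -> exists y : {y | p y}, x = val y.
    by rewrite AP => px; exists (Sub x px); rewrite SubK.
  exists (F f), (F c); split.
  - move=> _ _ /valA[x ->] /valA[y ->]; rewrite !FE => /finj -> //.
  - by move=> _ /valA[x ->]; rewrite FE; apply: cj.
  - move=> _ _ _ /valA[u ->] /valA[v ->] /valA[w ->]; rewrite !FE -!e'E.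
    by apply: con.
case=> f [c [finj cj con]]; exists (fun x => f (val x)), (fun x => c (val x)).
have vA (x : {y | p y}) : val x \in A by rewrite AP; apply: valP.
split.
- by move=> x y _ _ /finj E; apply: val_inj; apply: E.
- by move=> x _; apply: cj.
- by move=> u v w _ _ _; rewrite !e'E; apply: con.
Qed.

Lemma connect_ind (T : finType) (r : rel T) (P : T -> Prop) (x y : T) :
  connect r x y -> P x ->
  (forall a b, connect r x a -> r a b -> P a -> P b) -> P y.
Proof.
case/connectP=> p; elim/last_ind: p y => [|p b IH] y; first by move=> _ ->.
rewrite rcons_path last_rcons => /andP[xp rb] -> Px step.
apply: (step _ _ _ rb); first by apply/connectP; exists p.
exact: IH.
Qed.

(** * Branches of a tree: cuts, inclusions and disjointness *)

Section Tree.

Variables (T : finType) (e : rel T).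
Hypothesis treeT : is_tree e.

Let e_sym : symmetric e. Proof. by case: treeT. Qed.
Let e_symW x y : e x y -> e y x. Proof. by rewrite e_sym. Qed.
Let e_irr : irreflexive e. Proof. by case: treeT. Qed.
Let e_conn x y : connect e x y. Proof. by case: treeT. Qed.
Let e_acyclic : acyclic e. Proof. by case: treeT. Qed.

(** The vertices of the dangling tree from [v] in [u], kept as a subset of [T] so that branches can
    be compared by inclusion. *)
Definition branch (v u : T) : {set T} := [set y | connect (del_edge e v u) u y].

Lemma branch_root v u : u \in branch v u.
Proof. by rewrite inE connect0. Qed.

Lemma del_edge_sym v u : symmetric (del_edge e v u).
Proof.
move=> x y; rewrite /del_edge /= e_sym !xpair_eqE; congr (_ && _).
by rewrite andbC [(y == u) && _]andbC [(y == v) && _]andbC.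
Qed.

(** A repetition-free path from [u] to [v] closes to a cycle with the edge; acyclicity leaves only a
    loop or the deleted edge itself. *)
Lemma branch_bridge v u : e v u -> v \notin branch v u.
Proof.
move=> evu; apply/negP; rewrite inE => /connectP[p0 p0P lastp0].
case/shortenP: p0P lastp0 => p pP up _ lastp.
have pe : path e u p by apply: sub_path pP => x y /and3P[].
have /e_acyclic : ucycle e (u :: p) by rewrite /ucycle up /= rcons_path pe -lastp evu.
case: p pP lastp {pe up} => [|a [|//]] /=.
  by move=> _ vu; rewrite vu e_irr in evu.
by rewrite /del_edge /= => + va; rewrite -va !eqxx /= !andbF.
Qed.

(** Every edge other than the deleted one survives in [del_edge] and cannot leave the branch. Most
    tree arguments below rest on this cut property. *)
Lemma branch_leave v u y z : e v u -> y \in branch v u -> z \notin branch v u ->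
  e y z -> y = u /\ z = v.
Proof.
move=> evu yB zB eyz; have vB := branch_bridge evu.
have : ~~ del_edge e v u y z.
  apply: contra zB => yz; move: yB; rewrite !inE => /connect_trans; apply.
  exact: connect1.
rewrite /del_edge /= eyz /= negb_and !negbK => /orP[] /eqP[yE zE] //.
by rewrite yE (negPf vB) in yB.
Qed.

Lemma branch_step v u y z : e v u -> y \in branch v u -> e y z -> z != v ->
  z \in branch v u.
Proof.
move=> evu yB eyz; apply: contraR => zB.
by have [_ ->] := branch_leave evu yB zB eyz.
Qed.

Lemma branch_ind v u (P : T -> Prop) y : y \in branch v u -> P u ->
  (forall a b, a \in branch v u -> b \in branch v u -> e a b -> P a -> P b) -> P y.
Proof.
rewrite inE => uy Pu step; apply: connect_ind uy Pu _ => a b ua ab; apply: step.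
- by rewrite inE.
- by rewrite inE (connect_trans ua) ?connect1.
- by case/and3P: ab.
Qed.

(** A walk leaving [branch v' u'] must step from [u'] to [v'], which is impossible inside a branch
    missing one of them. *)
Lemma branch_sub v u v' u' : e v' u' -> u \in branch v' u' ->
  v' \notin branch v u \/ u' \notin branch v u -> branch v u \subset branch v' u'.
Proof.
move=> evu' uB' noB; apply/subsetP=> y yB.
apply: (branch_ind (P := fun y => y \in branch v' u') yB uB') =>
  a b aB bB eab aB'.
apply/negPn/negP=> bB'; have [aE bE] := branch_leave evu' aB' bB' eab.
by case: noB => /negP; apply; rewrite -?aE -?bE.
Qed.

(** A walk from [u] could enter the second branch only from [v], which is not in the first one. *)
Lemma branch_disjoint v u u' y : e v u -> e v u' -> u != u' ->
  y \in branch v u -> y \notin branch v u'.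
Proof.
move=> evu evu' uu' yB.
apply: (branch_ind (P := fun y => y \notin branch v u') yB) =>
  [|a b aB bB eab].
  apply: contra uu' => uB'.
  by have [-> _] := branch_leave evu' uB' (branch_bridge evu') (e_symW evu).
apply: contra => bB'; apply/negPn/negP=> aB'.
have [_ aE] := branch_leave evu' bB' aB' (e_symW eab).
by rewrite aE (negPf (branch_bridge evu)) in aB.
Qed.

(** A walk from [v] can enter the branch only at [u], which [Q] excludes. *)
Lemma branch_separates v u (Q : {pred T}) y : e v u -> u \notin Q ->
  connect [rel a b | [&& e a b, a \in Q & b \in Q]] v y -> y \notin branch v u.
Proof.
move=> evu uQ vy.
apply: (connect_ind (P := fun y => y \notin branch v u) vy (branch_bridge evu)) =>
  a b _ /and3P[eab aQ bQ].
apply: contra => bB; apply/negPn/negP=> aB.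
have [bE _] := branch_leave evu bB aB (e_symW eab).
by rewrite bE (negPf uQ) in bQ.
Qed.

Lemma thin_dangling_leP v u j : e v u ->
  thin (@dangling_adj T e v u) <= j <-> has_layout e (branch v u) j.
Proof.
move=> evu; apply: (@has_layout_val T e _ (connect (del_edge e v u) u)) => [y|y z];
  first by rewrite inE.
rewrite /dangling_adj /del_edge /=; case eyz: (e _ _) => //=.
have vB := branch_bridge evu.
have nv (x : dangling e v u) : val x != v.
  by apply: contraNneq vB => xE; rewrite -{1}xE inE; apply: (svalP x).
by rewrite !xpair_eqE (negPf (nv y)) (negPf (nv z)) andbF.
Qed.

Lemma thin_dangling_sub v u v' u' : e v u -> e v' u' ->
  branch v u \subset branch v' u' ->
  thin (@dangling_adj T e v u) <= thin (@dangling_adj T e v' u').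
Proof.
move=> evu evu' sub; apply/thin_dangling_leP => //.
by apply: has_layout_sub sub (leqnn _) _; apply/thin_dangling_leP.
Qed.

(** * A layout with [k] classes allows at most two [k]-neighbours *)

Section LowerBound.

Variables (k : nat) (f c : T -> nat) (x : T).
Hypotheses (k_gt0 : 0 < k) (lay : layout e [set: T] k f c).

Let f_inj : injective f.
Proof. by case: lay => finj _ _ y z; apply: finj; rewrite inE. Qed.

(** What a [k]-neighbour [v] of [x] contributes: vertices [X] of a thick dangling tree at [v] that
    pairwise cannot share a class, and their last vertex [t]. *)
Definition arm (v u : T) (X : {set T}) (t : T) : Prop :=
  [/\ [/\ e x v, e v u & u != x], X \subset branch v u, k <= #|X|,
      t \in X /\ (forall y, y \in X -> f y <= f t) &
      forall a b, a \in X -> b \in X -> f a < f b ->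
      exists w, [/\ w \in branch v u, f b < f w, e a w & ~~ e b w]].

Lemma k_neighbor_arm v : v \in k_neighbors e k x -> exists u X t, arm v u X t.
Proof.
rewrite inE => /andP[exv /existsP[u /and3P[evu ux kle]]].
have [|X [d [XB layX cl]]] := @order_clique _ e (branch v u) f.
  by move=> y z _ _ /f_inj.
have kX : k <= #|X|.
  by apply: leq_trans kle _; apply/thin_dangling_leP => //; exists f, d.
have /card_gt0P[t0 t0X] : 0 < #|X| by apply: leq_trans kX.
case: (arg_maxnP f t0X) => t tX tmax.
by exists u, X, t.
Qed.

Lemma arm_sub v u X t : arm v u X t -> branch v u \subset branch x v.
Proof.
case=> -[exv evu ux] _ _ _ _; apply: branch_sub => //.
  by apply: branch_step (branch_root _ _) evu ux.
left; apply/negP=> xB.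
have := branch_disjoint evu _ ux xB; rewrite e_sym exv branch_root.
by move/(_ isT).
Qed.

Lemma arm_neq v1 u1 X1 t1 v2 u2 X2 t2 :
  arm v1 u1 X1 t1 -> arm v2 u2 X2 t2 -> v1 != v2 -> f t1 != f t2.
Proof.
move=> A1 A2 nv; apply: contra_neq nv => /f_inj t12; apply/eqP/negPn/negP=> nv.
have [[ex1 _ _] /subsetP s1 _ [/s1 tB1 _] _] := A1.
have [[ex2 _ _] /subsetP s2 _ [/s2 tB2 _] _] := A2.
have := branch_disjoint ex1 ex2 nv (subsetP (arm_sub A1) _ tB1).
by rewrite t12 (subsetP (arm_sub A2) _ tB2).
Qed.

(** On the way from [t1] to [t3] inside [branch v2 x], which has no edge to [branch v2 u2], some
    edge [a b] jumps over [t2]. Then [a] and [X2] are more than [k] vertices in pairwise different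
    classes. *)
Lemma no_middle_arm v1 u1 X1 t1 v2 u2 X2 t2 v3 u3 X3 t3 :
  arm v1 u1 X1 t1 -> arm v2 u2 X2 t2 -> arm v3 u3 X3 t3 ->
  v1 != v2 -> v3 != v2 -> f t1 < f t2 -> f t2 < f t3 -> False.
Proof.
move=> A1 A2 A3 n12 n32 t12 t23.
have [[ex2 evu2 ux2] /subsetP X2B kX2 [t2X t2max] clique2] := A2.
have evx : e v2 x by rewrite e_sym.
have otherB v u X t : arm v u X t -> v != v2 -> t \in branch v2 x.
  move=> A nv; have [[exv _ _] /subsetP XB _ [/XB tB _] _] := A.
  have sub : branch x v \subset branch v2 x.
    apply: branch_sub => //; first exact: branch_step (branch_root _ _) exv nv.
    by right; apply: branch_bridge.
  by apply: (subsetP sub); apply: (subsetP (arm_sub A)).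
have t1B := otherB _ _ _ _ A1 n12; have t3B := otherB _ _ _ _ A3 n32.
have conn13 : connect (del_edge e v2 x) t1 t3.
  move: t1B t3B; rewrite !inE => xt1; apply: connect_trans.
  by rewrite (sym_connect_sym (@del_edge_sym v2 x)).
have disj y : y \in branch v2 x -> y \notin branch v2 u2.
  by apply: branch_disjoint; rewrite // eq_sym.
have nonadj d y : d \in branch v2 u2 -> y \in branch v2 x -> ~~ e d y.
  move=> dB yB; apply/negP=> edy; have [_ yE] := branch_leave evu2 dB (disj _ yB) edy.
  by rewrite yE (negPf (branch_bridge evx)) in yB.
suff : f t3 <= f t2 by rewrite leqNgt t23.
apply: (connect_ind (P := fun y => f y <= f t2) conn13 (ltnW t12)) => a b t1a ab fa.
rewrite leqNgt; apply/negP=> fb.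
have aB : a \in branch v2 x by move: t1B; rewrite !inE => /connect_trans; apply.
have bB : b \in branch v2 x.
  by move: aB; rewrite !inE => /connect_trans; apply; apply: connect1.
have eab : e a b by case/and3P: ab.
have aX : a \notin X2 by apply: contra (disj _ aB) => /X2B.
have {}fa : f a < f t2.
  by rewrite ltn_neqAle fa andbT; apply: contraNneq aX => /f_inj ->.
have [_ ck con] := lay.
(* If [a] comes first, the witness is [b]. If [a] comes second, it is the witness separating [y]
   from [t2]: it lies after [t2], in the branch, hence is not adjacent to [a]. *)
have apart y z : y \in a |: X2 -> z \in a |: X2 -> f y < f z -> c y != c z.
  move=> yX zX yz; apply/eqP=> cyz.
  suff [w [zw eyw /negP]] : exists w, [/\ f z < f w, e y w & ~~ e z w].
    by apply; apply: con yz zw cyz eyw; rewrite inE.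
  case/setU1P: yX yz {cyz} => [->|yX]; case/setU1P: zX => [->|zX].
  - by rewrite ltnn.
  - move=> _; exists b; split=> //; first exact: leq_ltn_trans (t2max z zX) fb.
    exact: nonadj (X2B _ zX) bB.
  - move=> ya; have [w [wB tw eyw _]] := clique2 _ _ yX t2X (ltn_trans ya fa).
    exists w; split=> //; first exact: ltn_trans fa tw.
    by rewrite e_sym; apply: nonadj.
  - by case/(clique2 _ _ yX zX)=> w [_ *]; exists w.
have : #|a |: X2| <= k.
  apply: (@card_inj_nat _ _ _ c) => [y _|y z yX zX cyz]; first by apply: ck; rewrite inE.
  apply: f_inj; case: (ltngtP (f y) (f z)) => // [yz|zy].
    by have := apart _ _ yX zX yz; rewrite cyz eqxx.
  by have := apart _ _ zX yX zy; rewrite cyz eqxx.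
by rewrite cardsU1 aX add1n leqNgt ltnS kX2.
Qed.

Lemma k_neighbors_leq2 : #|k_neighbors e k x| <= 2.
Proof.
rewrite leqNgt; apply/negP=> /card_gt2P[v1 [v2 [v3 [[N1 N2 N3] [n12 n23 n31]]]]].
have [u1 [X1 [t1 A1]]] := k_neighbor_arm N1.
have [u2 [X2 [t2 A2]]] := k_neighbor_arm N2.
have [u3 [X3 [t3 A3]]] := k_neighbor_arm N3.
have [n21 n32 n13] : [/\ v2 != v1, v3 != v2 & v1 != v3].
  by rewrite eq_sym n12 eq_sym n23 eq_sym n31.
have := arm_neq A1 A2 n12; have := arm_neq A2 A3 n23; have := arm_neq A3 A1 n31.
(* Two of the eight sign patterns are cyclic; in the other six some arm is in the middle. *)
case: (ltngtP (f t1) (f t2)) => // h12; case: (ltngtP (f t2) (f t3)) => // h23;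
  case: (ltngtP (f t3) (f t1)) => // h31 _ _ _.
- by have := ltn_trans (ltn_trans h12 h23) h31; rewrite ltnn.
- exact: no_middle_arm A1 A2 A3 _ _ h12 h23.
- exact: no_middle_arm A3 A1 A2 _ _ h31 h12.
- exact: no_middle_arm A1 A3 A2 _ _ h31 h23.
- exact: no_middle_arm A2 A3 A1 _ _ h23 h31.
- exact: no_middle_arm A2 A1 A3 _ _ h12 h31.
- exact: no_middle_arm A3 A2 A1 _ _ h23 h12.
- by have := ltn_trans (ltn_trans h23 h12) h31; rewrite ltnn.
Qed.

End LowerBound.

(** With [b <= N], the number [a * N.+1 + b] encodes the pair [(a, b)] lexicographically; the
    two-level vertex orders below have this form. *)
Lemma lex_ltn (N a b a' b' : nat) : b <= N -> b' <= N ->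
  a * N.+1 + b < a' * N.+1 + b' -> a < a' \/ a = a' /\ b < b'.
Proof. by move=> bN b'N; case: (ltngtP a a') => [|aa'|->]; nia. Qed.

Lemma lex_inj (N a b a' b' : nat) : b <= N -> b' <= N ->
  a * N.+1 + b = a' * N.+1 + b' -> a = a' /\ b = b'.
Proof. by move=> bN b'N; case: (ltngtP a a') => [aa'|aa'|->]; nia. Qed.

(** * Laying out a tree around a path *)

Section Caterpillar.

Variables (s : seq T) (x0 : T).
Hypotheses (x0s : x0 \in s) (sP : sorted e s) (s_uniq : uniq s).

Definition spine : {set T} := [set z | (z \in s) || [exists y in s, e y z]].

Lemma spine_path z : z \in s -> z \in spine.
Proof. by rewrite inE => ->. Qed.

Lemma path_connected a b : a \in s -> b \in s ->
  connect [rel y z | [&& e y z, y \in s & z \in s]] a b.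
Proof.
have rsym : symmetric [rel y z | [&& e y z, y \in s & z \in s]].
  by move=> y z /=; rewrite e_sym; congr (_ && _); apply: andbC.
case: s x0s sP rsym => // y p _ yp rsym.
have {}yp : path [rel a b | [&& e a b, a \in y :: p & b \in y :: p]] y p.
  apply: (sub_in_path (P := mem (y :: p)) _ _ yp); last by apply/allP.
  by move=> c d cP dP ecd; apply/and3P.
have from_y c : c \in y :: p -> connect [rel a b | [&& e a b, a \in y :: p & b \in y :: p]] y c.
  by move=> cS; apply: (path_connect yp).
move=> /from_y ya /from_y; apply: connect_trans.
by rewrite (sym_connect_sym rsym).
Qed.

Lemma spine_connected a b : a \in spine -> b \in spine ->
  connect [rel y z | [&& e y z, y \in spine & z \in spine]] a b.
Proof.
set r := rel_of_simpl _.
have rsym : symmetric r.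
  by move=> y z; rewrite /r /= e_sym; congr (_ && _); apply: andbC.
have from_x0 c : c \in spine -> connect r x0 c.
  have on_path d : d \in s -> connect r x0 d.
    move=> ds; apply: connect_sub (path_connected x0s ds) => y z /= /and3P[eyz ys zs].
    by apply: connect1; rewrite /r /= eyz !spine_path.
  move=> cS; move: (cS); rewrite inE => /orP[/on_path//|/existsP[d /andP[ds edc]]].
  apply: connect_trans (on_path d ds) (connect1 _).
  by rewrite /r /= edc cS spine_path.
move=> /from_x0 xa /from_x0; apply: connect_trans.
by rewrite (sym_connect_sym rsym).
Qed.

Lemma path_branch v u y : e v u -> v \in s -> u \notin s -> y \in s -> y \notin branch v u.
Proof.
move=> evu vs us ys; apply: (@branch_separates v u (mem s)) => //.
exact: path_connected.
Qed.

Lemma spine_branch v u y : e v u -> v \in spine -> u \notin spine -> y \in spine ->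
  y \notin branch v u.
Proof.
move=> evu vs us ys; apply: (@branch_separates v u (mem spine)) => //.
exact: spine_connected.
Qed.

(** A chord would close a cycle with the path segment between its ends. *)
Lemma path_adjacent a b : a \in s -> b \in s -> e a b ->
  index a s < index b s -> index b s = (index a s).+1.
Proof.
move=> aS; case/splitPr: aS sP s_uniq => p1 p2 sPs us bS eab.
have nap : a \notin p1 by move: us; rewrite cat_uniq /= negb_or => /and3P[_ /andP[]].
have ia : index a (p1 ++ a :: p2) = size p1.
  by rewrite index_cat (negPf nap) /= eqxx addn0.
have ba : b != a by apply: contraTneq eab => ->; rewrite e_irr.
rewrite ia => lt_ab.
have nbp : b \notin p1.
  by apply/negP=> bp; move: lt_ab; rewrite index_cat bp ltnNge ltnW // index_mem.
have bp2 : b \in p2 by move: bS; rewrite mem_cat inE (negPf nbp) (negPf ba).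
rewrite index_cat (negPf nbp) /= eq_sym (negPf ba).
have /= pth : sorted e (a :: p2) by have [] := cat_sorted2 sPs.
have un : uniq (a :: p2) by move: us; rewrite cat_uniq => /and3P[].
case/splitPr: bp2 pth un {lt_ab bS ia sPs us} => p3 p4.
rewrite -cat_rcons cat_path -cat_cons cat_uniq => /andP[ap _] /and3P[up _ _].
have /e_acyclic : ucycle e (a :: rcons p3 b).
  by rewrite /ucycle up andbT /= rcons_path ap last_rcons e_sym eab.
by rewrite /= size_rcons; case: p3 {ap up} => //= _; rewrite eqxx addn1.
Qed.

(** The path stays out of [branch y v], whose only exit leads from [v] to [y]. *)
Lemma path_uniq_nbr v y y' : v \notin s -> y \in s -> y' \in s -> e y v -> e y' v -> y = y'.
Proof.
move=> vs ys y's eyv ey'v.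
have [_ ->] := branch_leave eyv (branch_root _ _) (path_branch eyv ys vs y's) (e_symW ey'v).
by [].
Qed.

(** An edge [u w] would put [w] into [branch y u]; leaving that branch towards [y'] forces
    [w = u]. *)
Lemma path_nbrs_indep u w y y' : u \notin s -> w \notin s -> y \in s -> y' \in s ->
  e y u -> e y' w -> ~~ e u w.
Proof.
move=> us ws ys y's eyu ey'w; apply/negP=> euw.
have wB : w \in branch y u.
  apply: branch_step (branch_root _ _) euw _ => //.
  by apply: contraNneq ws => ->.
have [wE _] := branch_leave eyu wB (path_branch eyu ys us y's) (e_symW ey'w).
by rewrite wE e_irr in euw.
Qed.

(** For an off-path spine vertex this is its path neighbour, unique by [path_uniq_nbr]; the default
    [z] is reached only outside the spine. *)
Definition owner (z : T) : T :=
  if z \in s then z else odflt z [pick y | (y \in s) && e y z].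

Lemma ownerP z : z \in spine -> owner z \in s /\ (z \notin s -> e (owner z) z).
Proof.
rewrite inE /owner; case: ifP => //= zs /existsP[y yP].
by case: pickP => [y' /andP[]|/(_ y)]; rewrite ?yP.
Qed.

(* The neighbours of a path vertex come just before it; [enum_rank] separates
   them. *)
Definition spine_key (z : T) : nat :=
  index (owner z) s * #|T|.+1 + (if z \in s then #|T| else enum_rank z).

Let second_key z : (if z \in s then #|T| else enum_rank z) <= #|T|.
Proof. by case: ifP => // _; apply: ltnW. Qed.

Lemma owner_index u v : u \in spine -> v \in spine ->
  index (owner u) s = index (owner v) s -> owner u = owner v.
Proof.
move=> /ownerP[us _] /ownerP[vs _] ix.
by rewrite -(nth_index x0 us) ix nth_index.
Qed.

Lemma spine_key_inj : {in spine &, injective spine_key}.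
Proof.
move=> u v uS vS /lex_inj []; try exact: second_key.
move/owner_index=> /(_ uS vS); rewrite /owner.
case: ifP => us; case: ifP => vs //= _.
- by move=> E; have := ltn_ord (enum_rank v); rewrite -E ltnn.
- by move=> E; have := ltn_ord (enum_rank u); rewrite E ltnn.
- by move/ord_inj/enum_rank_inj.
Qed.

(** A forward edge [u w] ends at a path vertex [w], and [u] is the preceding path vertex or an
    off-path neighbour of [w]. All spine vertices in between are off-path neighbours of [w], so one
    class suffices for the spine. *)
Lemma spine_key_consistent u v w : u \in spine -> v \in spine -> w \in spine ->
  spine_key u < spine_key v -> spine_key v < spine_key w -> e u w -> e v w.
Proof.
move=> uS vS wS uv vw euw.
have [ous ou] := ownerP uS; have [ovs ov] := ownerP vS; have [ows ow] := ownerP wS.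
have uw := ltn_trans uv vw.
have {uv} := lex_ltn (second_key u) (second_key v) uv.
have {vw} := lex_ltn (second_key v) (second_key w) vw.
have {uw} := lex_ltn (second_key u) (second_key w) uw.
have nlt (z : T) : (#|T| < enum_rank z) = false by rewrite ltnNge (ltnW (ltn_ord _)).
have close : v \notin s -> owner v = w -> e v w.
  by move=> vs <-; apply: e_symW; apply: ov.
have own z : z \in s -> owner z = z by rewrite /owner => ->.
case: (boolP (u \in s)) ou => [us _|us /(_ isT) ou].
  rewrite (own u us); case: (boolP (w \in s)) ow => [ws _|ws /(_ isT) ow].
    rewrite (own w ws) ltnn => -[|[_ //]] uw.
    have iw := path_adjacent us ws euw uw.
    case: (boolP (v \in s)) => [vs|vs] vw uv.
      rewrite !ltnn in vw uv; case: vw uv => [vw|[]//] [uv|[]//].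
      by rewrite iw ltnS leqNgt uv in vw.
    apply: close => //; rewrite -(own w ws); apply: owner_index => //.
    rewrite nlt in uv; rewrite (own w ws); case: vw uv => [vw|[]//] [uv|[]//].
    by rewrite iw ltnS leqNgt uv in vw.
  have -> : owner w = u by apply: path_uniq_nbr ow euw.
  by rewrite ltnn nlt => -[|[]].
case: (boolP (w \in s)) ow => [ws _|ws /(_ isT) ow].
  have owu : owner u = w.
    by apply: (path_uniq_nbr (v := u)) => //; apply: e_symW.
  rewrite owu (own w ws) ltnn.
  case: (boolP (v \in s)) => [vs|vs] _ vw uv.
    case: vw uv => [vw|[_]]; last by rewrite ltnn.
    by case=> [uv|[uv _]]; rewrite ?uv ?ltnn // ltnNge ltnW in vw.
  apply: close => //; rewrite -(own w ws); apply: owner_index => //.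
  by rewrite (own w ws); case: vw uv => [vw|[//]] [uv|[//]]; rewrite ltnNge ltnW in vw.
by have := path_nbrs_indep us ws ous ows ou ow; rewrite euw.
Qed.

(** Along a walk from [x0], each exit from the spine opens a branch, and the walk stays in it until
    it meets the spine again. *)
Lemma spine_cover z : z \notin spine ->
  exists v u, [/\ v \in spine, u \notin spine, e v u & z \in branch v u].
Proof.
pose P y := y \notin spine -> exists v u,
  [/\ v \in spine, u \notin spine, e v u & y \in branch v u].
suff : P z by [].
apply: (connect_ind (P := P) (e_conn x0 z)); first by rewrite /P spine_path.
move=> a b _ eab IH bS; case: (boolP (a \in spine)) => [aS|/IH[v [u [vS uS evu aB]]]].
  by exists a, b; split=> //; apply: branch_root.
exists v, u; split=> //; apply: branch_step aB eab _ => //.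
by apply: contraNneq bS => ->.
Qed.

Definition anchors (z v : T) : bool :=
  (v \in spine) && [exists u, [&& u \notin spine, e v u & z \in branch v u]].

(** The spine vertex at which the hanging tree of [z] is attached; by [spine_cover] the default is
    never taken. *)
Definition anchor (z : T) : T := if z \in spine then z else odflt z [pick v | anchors z v].

Lemma anchor_spine z : anchor z \in spine.
Proof.
rewrite /anchor; case: ifP => // /negbT/spine_cover[v [u [vS uS evu zB]]].
case: pickP => [y /andP[]//|/(_ v)]; rewrite /anchors vS /= => /existsP[].
by exists u; rewrite uS evu zB.
Qed.

Lemma anchor_id z : z \in spine -> anchor z = z.
Proof. by rewrite /anchor => ->. Qed.

Lemma anchor_adj v z : v \in spine -> z \notin spine -> e v z -> anchor z = v.
Proof.
move=> vS zS evz; rewrite /anchor (negPf zS); case: pickP => [y|/(_ v)].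
  case/andP=> yS /existsP[u /and3P[uS eyu zB]] /=.
  by have [_ ->] := branch_leave eyu zB (spine_branch eyu yS uS vS) (e_symW evz).
rewrite /anchors vS /= => /existsP[].
by exists z; rewrite zS evz branch_root.
Qed.

Lemma anchor_eq z z' : z \notin spine -> z' \notin spine -> e z z' -> anchor z = anchor z'.
Proof.
move=> zS z'S ezz'.
have sub y y' : y' \notin spine -> e y y' -> subpred (anchors y) (anchors y').
  move=> y'S eyy' v /andP[vS /existsP[u /and3P[uS evu yB]]].
  rewrite /anchors vS; apply/existsP; exists u; rewrite uS evu.
  by apply: branch_step yB eyy' _ => //; apply: contraNneq y'S => ->.
have eqA : anchors z =1 anchors z'.
  by move=> v; apply/idP/idP; apply: sub => //; apply: e_symW.
rewrite /anchor (negPf zS) (negPf z'S) (eq_pick eqA).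
by case: pickP => // no; have := anchor_spine z'; rewrite /anchor (negPf z'S);
  case: pickP => [y|]; rewrite ?no //= (negPf z'S).
Qed.

Lemma caterpillar_layout j :
  (forall y v u, y \in s -> e y v -> v \notin s -> e v u -> u \notin s ->
    has_layout e (branch v u) j) ->
  has_layout e [set: T] j.+1.
Proof.
move=> small.
have [l [c [l_inj c_lt con]]] : has_layout e (~: spine) j.
  apply: has_layout_cover => // z; rewrite inE => /spine_cover[v [u [vS uS evu zB]]].
  exists (branch v u); split=> //; last first.
    move=> y y' yB; rewrite inE => y'S eyy'; apply: branch_step yB eyy' _ => //.
    by apply: contraNneq y'S => ->.
  have us : u \notin s by apply: contra uS => /spine_path.
  have vs : v \notin s.
    apply: contra uS => vs; rewrite inE; apply/orP; right.
    by apply/existsP; exists v; rewrite vs.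
  move: vS; rewrite inE (negPf vs) => /existsP[y /andP[ys eyv]].
  exact: small ys eyv vs evu us.
pose L := (\max_z l z).+1.
(* Zero puts a spine vertex before the trees anchored at it, whose vertices keep the order [l]. The
   hanging trees share the classes below [j], and the spine gets class [j]. *)
pose k2 z := if z \in spine then 0 else (l z).+1.
have k2L z : k2 z <= L.
  by rewrite /k2; case: ifP => // _; rewrite ltnS; apply: leq_bigmax.
have ancS := anchor_spine.
exists (fun z => spine_key (anchor z) * L.+1 + k2 z), (fun z => if z \in spine then j else c z).
split.
- move=> y z _ _ /(lex_inj (k2L y) (k2L z))[/spine_key_inj ayz].
  have {}ayz : anchor y = anchor z by apply: ayz.
  rewrite /k2; case: ifP => yS; case: ifP => zS //.
    by move: ayz; rewrite !anchor_id.
  by case=> /l_inj; apply; rewrite inE ?yS ?zS.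
- move=> z _; case: ifP => // /negbT zS; apply: leqW; apply: c_lt.
  by rewrite inE.
move=> u v w _ _ _ uv vw ceq euw.
have {uv} := lex_ltn (k2L u) (k2L v) uv.
have {vw} := lex_ltn (k2L v) (k2L w) vw.
move: ceq; case: ifP => uS; case: ifP => vS.
- move=> _; rewrite (anchor_id uS) (anchor_id vS).
  case: (boolP (w \in spine)) => wS.
    rewrite (anchor_id wS) /k2 uS vS wS !ltnn => -[vw|[]//] [uv|[]//].
    exact: spine_key_consistent uv vw euw.
  rewrite (anchor_adj uS wS euw) /k2 uS vS ltnn => vw [uv|[]//].
  case: vw => [vu|[E _]]; first by have := ltn_trans uv vu; rewrite ltnn.
  by rewrite E ltnn in uv.
- by move=> E; have := c_lt v; rewrite inE vS -E ltnn => /(_ isT).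
- by move=> E; have := c_lt u; rewrite inE uS E ltnn => /(_ isT).
move=> ceq; move/negbT: uS => uS; move/negbT: vS => vS.
(* Here [u] and [v] are off the spine. A spine vertex [w] would be the anchor of [u] and precede it;
   otherwise all three have the same anchor and [l] decides. *)
case: (boolP (w \in spine)) => wS.
  rewrite (anchor_adj wS uS (e_symW euw)) (anchor_id wS) /k2 wS ltn0 => -[vw|[]//].
  case=> [wv|[E _]]; first by have := ltn_trans vw wv; rewrite ltnn.
  by rewrite E ltnn in vw.
rewrite (anchor_eq uS wS euw) /k2 (negPf uS) (negPf vS) (negPf wS) !ltnS.
case=> [vw|[E vw]]; case=> [uv|[E' uv]].
- by have := ltn_trans vw uv; rewrite ltnn.
- by rewrite E' ltnn in vw.
- by rewrite E ltnn in uv.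
- by apply: con uv vw ceq euw; rewrite inE.
Qed.

End Caterpillar.

Lemma sorted_rcons2 (A : Type) (r : rel A) (s : seq A) (x y : A) :
  sorted r (rcons s x) -> r x y -> sorted r (rcons (rcons s x) y).
Proof.
case: s => [|a s] /= sx rxy; first by rewrite rxy.
by rewrite (rcons_path _ _ (rcons s x)) last_rcons sx.
Qed.

(** * A path closed under [k]-neighbours, and the bound it gives *)

Section UpperBound.

Variable k : nat.

Local Notation N := (k_neighbors e k).

Lemma k_neighborsP x v :
  reflect (e x v /\ exists u, [/\ e v u, u != x & k <= thin (@dangling_adj T e v u)])
          (v \in N x).
Proof.
rewrite inE; apply: (iffP andP) => -[exv].
  by case/existsP=> u /and3P[]; split=> //; exists u.
by case=> u [? ? ?]; split=> //; apply/existsP; exists u; apply/and3P.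
Qed.

Lemma k_neighbor_adj x v : v \in N x -> e x v.
Proof. by case/k_neighborsP. Qed.

(* The thick tree beyond a k-neighbour [p] of [z] is also seen, through [z],
   from every other neighbour of [z]. *)
Lemma k_neighbor_back p z w : p \in N z -> e z w -> w != p -> z \in N w.
Proof.
case/k_neighborsP=> ezp [q [epq qz kq]] ezw wp.
apply/k_neighborsP; split; first exact: e_symW.
exists p; split=> //; first by rewrite eq_sym.
apply: leq_trans kq _; apply: thin_dangling_sub => //; apply: branch_sub => //.
  by apply: branch_step (branch_root _ _) epq qz.
left; apply/negP=> zB; have := branch_disjoint epq (e_symW ezp) qz zB.
by rewrite branch_root.
Qed.

Definition closed_path (s : seq T) : Prop :=
  [/\ s != [::], sorted e s, uniq s & forall y, y \in s -> N y \subset s].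

Definition mutual : rel T := [rel x y | (x \in N y) && (y \in N x)].

Lemma mutual_adj : subrel mutual e.
Proof. by move=> x y /andP[_ /k_neighbor_adj]. Qed.

Lemma mutual_sym : symmetric mutual.
Proof. by move=> x y; apply: andbC. Qed.

Hypothesis N_leq2 : forall x, #|N x| <= 2.

(** Let [w] be a [k]-neighbour of [z] on the path, itself off the path. Since [z] has a
    [k]-neighbour on the path, [z] and [w] are mutual; an inner [z] would have three [k]-neighbours,
    so [z] is an end and the path can be extended by [w]. *)
Lemma mutual_path_closed s : sorted mutual s -> uniq s -> 1 < size s ->
  exists s', closed_path s'.
Proof.
have [n] := ubnP (#|T| - size s); elim: n s => // n IH s; rewrite ltnS => le_n sM su s1.
have [allN|] := boolP [forall y in s, N y \subset s].
  exists s; split=> //; last exact/forall_inP.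
    by rewrite -size_eq0 -lt0n ltnW.
  exact: sub_sorted mutual_adj _ sM.
case/forall_inPn=> z zs /subsetPn[w wN ws].
have extend s' : sorted mutual s' -> uniq s' -> size s' = (size s).+1 ->
    exists s'', closed_path s''.
  move=> s'M s'u s'E; apply: (IH s' _ s'M s'u); last by rewrite s'E ltnW.
  have : size s' <= #|T| by rewrite -(card_uniqP s'u) max_card.
  by rewrite s'E; lia.
have ezw := k_neighbor_adj wN.
have mutual_w p : p \in s -> p \in N z -> mutual z w.
  move=> ps pN; rewrite /mutual /= wN andbT.
  by apply: k_neighbor_back pN ezw _; apply: contraNneq ws => ->.
case/splitPr: zs ws sM su s1 extend mutual_w {le_n} => p1 p2 ws sM su s1 extend mutual_w.
case: (lastP p1) => [|p1' a] in ws sM su s1 extend mutual_w *.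
  case: p2 => // b p2 in ws sM su s1 extend mutual_w *.
  have zw : mutual z w.
    apply: (mutual_w b); first by rewrite !inE eqxx orbT.
    by case/andP: sM => /andP[].
  apply: (extend [:: w, z, b & p2]) => //; last by rewrite cons_uniq ws.
  by apply/andP; split; [rewrite mutual_sym | exact: sM].
have az : mutual a z.
  by move: sM; rewrite cat_rcons => /cat_sorted2[_] /= /andP[].
have aN : a \in N z by case/andP: az.
have zw : mutual z w by apply: (mutual_w a); rewrite // mem_cat mem_rcons inE eqxx.
case: p2 => [|b p2] in ws sM su s1 extend mutual_w *.
  rewrite cats1 in ws sM su extend.
  apply: (extend (rcons (rcons (rcons p1' a) z) w)); last by rewrite size_rcons.
    exact: sorted_rcons2.
  by rewrite rcons_uniq ws.
have bN : b \in N z.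
  by move: sM => /cat_sorted2[_] /= /andP[/andP[]].
have ab : a != b.
  move: su; rewrite cat_uniq => /and3P[_ /hasPn/(_ b) + _].
  by rewrite !inE eqxx orbT => /(_ isT); rewrite mem_rcons inE negb_or eq_sym => /andP[].
have wa : w != a by apply: contraNneq ws => ->; rewrite mem_cat mem_rcons inE eqxx.
have wb : w != b by apply: contraNneq ws => ->; rewrite mem_cat !inE eqxx !orbT.
have := N_leq2 z; rewrite leqNgt => /negP[]; apply/card_gt2P.
by exists w, a, b; split; split; rewrite // eq_sym.
Qed.

Lemma exists_closed_path : exists s, closed_path s.
Proof.
have /card_gt0P[x0 _] : 0 < #|T| by case: treeT.
have [/existsP[z /eqP Nz] | noempty] := boolP [exists z, N z == set0].
  exists [:: z]; split=> // y; rewrite inE => /eqP ->.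
  by rewrite Nz; apply/subsetP=> v; rewrite inE.
have ex z : exists y, y \in N z.
  by apply/set0Pn; apply: contra noempty => Nz; apply/existsP; exists z.
have [y0 y0N] := ex x0.
pose Q (p : T * T) := p.2 \in N p.1.
(* A [k]-neighbour [w] of [y] other than [z] would give the branch from [y] in [w], contained in the
   one from [z] in [y] but missing [y], against minimality. *)
have [[z y] /= yN ymin] := @arg_minnP _ (x0, y0) Q (fun p => #|branch p.1 p.2|) y0N.
have {}yN : y \in N z := yN.
have [w wN] := ex y; have [wz|nwz] := eqVneq w z.
  apply: (@mutual_path_closed [:: z; y]) => //=; first by rewrite /mutual /= yN -wz wN.
  by rewrite inE andbT; apply: contraTneq (k_neighbor_adj yN) => ->; rewrite e_irr.
have ezy := k_neighbor_adj yN; have eyw := k_neighbor_adj wN.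
have := ymin (y, w) wN; rewrite leqNgt => /negP[] /=.
apply/proper_card/properP; split; last first.
  by exists y; [apply: branch_root | apply: branch_bridge].
apply: branch_sub => //; first exact: branch_step (branch_root _ _) eyw nwz.
left; apply/negP=> zB; have := branch_disjoint eyw (e_symW ezy) nwz zB.
by rewrite branch_root.
Qed.

Lemma thin_leq : 0 < k -> thin e <= k.
Proof.
move=> k_gt0; have [s [sn sP su sN]] := exists_closed_path.
have [x0 x0s] : exists x0, x0 \in s.
  by case: s sn {sP su sN} => // x s _; exists x; rewrite mem_head.
(* One class goes to the spine, leaving [k.-1] for the hanging trees. A hanging tree of thinness at
   least [k] would make [v] a [k]-neighbour of [y], hence a path vertex. *)
apply/thin_leP; rewrite -(prednK k_gt0).
apply: (caterpillar_layout x0s sP su) => y v u ys eyv vs evu us.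
apply/thin_dangling_leP => //; rewrite -ltnS prednK // ltnNge.
apply: contra vs => ku; apply: (subsetP (sN y ys)).
apply/k_neighborsP; split=> //; exists u; split=> //.
by apply: contraNneq us => ->.
Qed.

End UpperBound.

End Tree.

Theorem theorem11 (k : nat) (T : finType) (e : rel T) :
  0 < k -> is_tree e ->
  (k < thin e <-> exists x : T, 3 <= #|k_neighbors e k x|).
Proof.
move=> k_gt0 treeT; split=> [|[x]].
  have [/existsP //|/existsPn no3] := boolP [exists x, 3 <= #|k_neighbors e k x|].
  rewrite ltnNge (thin_leq treeT _ k_gt0) // => x.
  by have := no3 x; rewrite -leqNgt.
apply: contraTltn; rewrite -leqNgt => /thin_leP[f [c lay]].
exact: k_neighbors_leq2 lay.
Qed.
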